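(* Let $n,d$ be positive integers with $1\le d<\frac{n-1}{2}$. Any eigenvalue of $C_n^{(d)}$ of odd multiplicity must necessarily be $2d$, $0$ or $-2$.
   Context: $C_n$ denotes the circuit (cycle) graph on $n$ vertices. For a graph $G$ and a positive integer $d$, the $d$-th distance power $G^{(d)}$ is the graph obtained from $G$ by adding edges between all pairs of distinct vertices whose distance in $G$ is at most $d$. The eigenvalues of a graph, and their multiplicities, are those of its adjacency matrix. The condition $1\le d<\frac{n-1}{2}$ expresses that $C_n^{(d)}$ is non-complete. *)

(* Defs.v *)
From mathcomp Require Import all_boot all_order all_algebra.
Set Implicit Arguments.
Unset Strict Implicit.
Unset Printing Implicit Defensive.

Import GRing.Theory.
Local Open Scope ring_scope.

(* Simple graphs on a finite vertex type are represented by their adjacency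
   relation, a symmetric and irreflexive [rel]. *)

(* The conjunct [i != j] only matters for n = 1, where it rules out a loop. *)
Definition circuit (n : nat) : rel 'I_n := fun i j =>
  (i != j) &&
  ((j == i.+1 %% n :> nat)%N || (i == j.+1 %% n :> nat)%N).

Definition walk (T : finType) (e : rel T) (k : nat) (x y : T) : bool :=
  [exists p : k.-tuple T, path e x p && (last x p == y)].

(* Length of a shortest walk from x to y. A shortest walk repeats no vertex,
   so lengths below #|T| suffice; the value is the dummy #|T| when no walk
   exists, hence this is to be used together with [connect e x y]. *)
Definition gdist (T : finType) (e : rel T) (x y : T) : nat :=
  find (fun k => walk e k x y) (iota 0 #|T|).

(* For d > 0 this contains e: adjacent vertices are at distance 1. *)
Definition dist_power (T : finType) (e : rel T) (d : nat) : rel T := fun x y =>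
  [&& x != y, connect e x y & (gdist e x y <= d)%N].

Definition adjacency (R : pzSemiRingType) (n : nat) (e : rel 'I_n) : 'M[R]_n :=
  \matrix_(i, j) (e i j)%:R.

(* Algebraic multiplicity; for a real symmetric matrix, such as an adjacency
   matrix, it equals the dimension of the eigenspace. *)
Definition eig_mult (F : fieldType) (n : nat) (A : 'M[F]_n) (a : F) : nat :=
  mup a (char_poly A).

(* Main.v *)
Require Import Defs.
From mathcomp Require Import all_boot all_order all_algebra.
From mathcomp Require Import cyclic separable cyclotomic.
From mathcomp Require Import complex.
From mathcomp Require Import zify.
Set Implicit Arguments.
Unset Strict Implicit.
Unset Printing Implicit Defensive.

Import GRing.Theory Num.Theory.
Local Open Scope ring_scope.

(** The distance power of a circuit is a circulant graph, so it is diagonalized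
    by the Vandermonde matrix of the n-th roots of unity: the vector of powers
    of such a root z is an eigenvector for
      [power_eig d z] = sum over 1 <= m <= d of (z ^ m + z ^ -m).
    This uses that the neighbours of x are the 2d distinct residues x + m and
    x - m with 1 <= m <= d ([nbr_seq_uniq], [mem_nbr_seq]). Hence the
    multiplicity of lam is the number of n-th roots of unity z with
    [power_eig d z] = lam ([eig_mult_dist_power_circuit]).

    Since [power_eig d] takes the same value at z and at its inverse, inversion
    acts on that set of roots. An involution of a set of odd size has a fixed
    point ([even_card_involutive]), and the only roots of unity equal to their
    inverse are 1 and -1. The value at 1 is 2d, and the value at -1 is an
    alternating sum equal to 0 or -2 ([power_eig_selfinverse]).

    The roots of unity live in R[i]; multiplicities are transported there along
    the embedding of R ([mup_map_poly]). *)

(** * Parity, multiplicities and diagonalization *)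

(** All orbits of such an involution inside S have exactly two elements. *)
Lemma even_card_involutive (T : finType) (f : T -> T) (S : {pred T}) :
  involutive f -> {homo f : x / x \in S} -> {in S, forall x, f x != x} ->
  ~~ odd #|S|.
Proof.
move=> fK fS fN.
have cycf x : fcycle f [:: x; f x] by rewrite /= fK !eqxx.
have <- : (fcard f S * 2 = #|S|)%N.
  apply: fcard_order_set; first exact: inv_inj.
    apply/subsetP => x xS; rewrite inE.
    rewrite (order_cycle (cycf x)) ?inE ?eqxx //=.
    by rewrite inE eq_sym fN.
  move=> x _ /eqP <-; apply/idP/idP; first exact: fS.
  by move/fS; rewrite fK.
by rewrite oddM andbF.
Qed.

(** Divisibility by a power of 'X - a can be tested after a field extension. *)
Lemma mup_map_poly (F K : fieldType) (f : {rmorphism F -> K}) (a : F)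
    (p : {poly F}) : p != 0 -> mup (f a) (map_poly f p) = mup a p.
Proof.
move=> p0; have fp0 : map_poly f p != 0 by rewrite map_poly_eq0.
have E k : (k <= mup (f a) (map_poly f p))%N = (k <= mup a p)%N.
  by rewrite !mup_geq // -(dvdp_map f) rmorphXn /= map_polyXsubC.
by apply/eqP; rewrite eqn_leq -E leqnn E leqnn.
Qed.

(** The relation A V = V D, with V and D viewed over the polynomials, also holds
    between the characteristic matrices of A and D; taking determinants allows
    cancelling that of V. *)
Lemma char_poly_diagonalized (F : fieldType) n (A V : 'M[F]_n) (mu : 'rV[F]_n) :
  \det V != 0 -> A *m V = V *m diag_mx mu ->
  char_poly A = \prod_(j < n) ('X - (mu 0 j)%:P).
Proof.
move=> V0 AV; rewrite -[RHS](_ : char_poly (diag_mx mu) = _); last first.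
  rewrite char_poly_trig ?diag_mx_is_trig //.
  by apply: eq_bigr => j _; rewrite mxE eqxx.
have PV0 : \det (map_mx polyC V) != 0 by rewrite det_map_mx polyC_eq0.
apply: (mulIf PV0); rewrite [RHS]mulrC /char_poly -!det_mulmx; congr (\det _).
rewrite /char_poly_mx mulmxBl mulmxBr -!map_mxM AV.
by rewrite mul_scalar_mx mul_mx_scalar.
Qed.

Lemma det_Vandermonde_neq0 (F : fieldType) n (a : 'rV[F]_n) :
  injective (a 0) -> \det (Vandermonde n a) != 0.
Proof.
move=> inja; rewrite det_Vandermonde; apply/prodf_neq0 => i _.
apply/prodf_neq0 => j ij; rewrite subr_eq0; apply/eqP => /inja ji.
by rewrite ji ltnn in ij.
Qed.

(** In characteristic 0 the polynomial 'X^n - 1 is separable, so it has n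
    distinct roots, which is enough for one of them to be primitive. *)
Lemma prim_root_exists (C : numClosedFieldType) n :
  (n > 0)%N -> exists z : C, n.-primitive_root z.
Proof.
move=> n0; pose p : {poly C} := 'X^n - 1.
have [r Dp] := closed_field_poly_normal p.
rewrite (monicP _) ?monicXnsubC // scale1r in Dp.
have rn1 : all n.-unity_root r.
  by apply/allP => z; rewrite -root_prod_XsubC -Dp.
have sz_r : (n < (size r).+1)%N.
  by rewrite -(size_prod_XsubC r id) -Dp size_XnsubC.
have [|z _ zP] := hasP (has_prim_root n0 rn1 _ sz_r); last by exists z.
by rewrite -separable_prod_XsubC -Dp separable_Xn_sub_1 // pnatr_eq0 -lt0n.
Qed.

(** * Distances in the circuit *)

(** The bound on d keeps the dummy value #|T| of [gdist] out of play. *)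
Lemma dist_powerP (T : finType) (e : rel T) (d : nat) (x y : T) :
  (d < #|T|)%N ->
  reflect (x != y /\ exists2 k, (k <= d)%N & walk e k x y) (dist_power e d x y).
Proof.
move=> dT; apply: (iffP and3P) => [[xy _ le_d]|[xy [k kd w]]].
  split=> //; exists (gdist e x y) => //; move: le_d; rewrite /gdist.
  set P := fun k => _; move=> le_d; have lt : (find P (iota 0 #|T|) < #|T|)%N.
    exact: leq_ltn_trans dT.
  have := @nth_find _ 0%N P (iota 0 #|T|).
  by rewrite nth_iota // has_find size_iota; apply.
split=> //.
  by have /existsP[p /andP[ep /eqP <-]] := w; apply/connectP; exists p.
apply: leq_trans kd; rewrite leqNgt; apply/negP => lt.
have kT : (k < #|T|)%N.
  by apply: leq_trans lt _; rewrite /gdist (leq_trans (find_size _ _)) ?size_iota.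
by have := before_find 0%N lt; rewrite nth_iota // w.
Qed.

Lemma walk_iter (T : finType) (e : rel T) (f : T -> T) k x :
  (forall z, e z (f z)) -> walk e k x (iter k f x).
Proof.
move=> ef; apply/existsP.
have sz : size (traject f (f x) k) == k by rewrite size_traject.
exists (Tuple sz); rewrite /= last_traject eqxx andbT.
by apply: sub_path (fpath_traject f x k) => a _ /eqP <-.
Qed.

Lemma val_natr n (m : nat) : (m%:R : 'I_n.+2) = (m %% n.+2)%N :> nat.
Proof. by rewrite Zp_nat. Qed.

Lemma circuitE n (x y : 'I_n.+2) :
  circuit x y = (y == x + 1) || (y == x - 1).
Proof.
have S (a b : 'I_n.+2) : (b == a.+1 %% n.+2 :> nat)%N = (b == a + 1).
  by rewrite -val_eqE /= modnDmr addn1.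
have -> : (y == x - 1) = (x == y + 1) by rewrite eq_sym subr_eq.
rewrite /circuit !S; case: (x =P y) => //= <-.
by rewrite -subr_eq0 opprD addrA subrr sub0r oppr_eq0 oner_eq0.
Qed.

(** On residues modulo the order of the circuit, a walk adds a sum of k signs,
    hence plus or minus some m <= k. *)
Lemma walk_circuit n k (x y : 'I_n.+2) :
  walk (@circuit n.+2) k x y ->
  exists2 m, (m <= k)%N & y = x + m%:R \/ y = x - m%:R.
Proof.
case/existsP=> -[s /= /eqP <-] /andP[].
elim: s x => [|z s IHs] x /=.
  by move=> _ /eqP <-; exists 0%N => //; left; rewrite addr0.
rewrite circuitE => /andP[xz es] /(IHs _ es) [m ms zy].
have [m0|m0] := posnP m.
  rewrite m0 subr0 addr0 in zy; exists 1%N => //.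
  by case: zy => ->; case/orP: xz => /eqP ->; [left|right|left|right].
have mE : (m%:R : 'I_n.+2) = 1 + m.-1%:R by rewrite -mulrS prednK.
(* A step against the direction of the displacement shortens it by one. *)
case/orP: xz zy => /eqP -> [] ->.
- by exists m.+1 => //; left; rewrite mulrS addrA.
- exists m.-1; first lia.
  by right; rewrite mE opprD addrA addrK.
- exists m.-1; first lia.
  by left; rewrite mE addrA subrK.
- by exists m.+1 => //; right; rewrite mulrS opprD addrA.
Qed.

(** The converse: going m times in one direction. *)
Lemma circuit_walk n m (x : 'I_n.+2) :
  walk (@circuit n.+2) m x (x + m%:R) /\ walk (@circuit n.+2) m x (x - m%:R).
Proof.
have iterD (a : 'I_n.+2) : iter m (+%R^~ a) x = x + a *+ m.
  by elim: m => [|k IHk] /=; rewrite ?addr0 // IHk mulrSr addrA.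
split.
  by rewrite -iterD; apply: walk_iter => z; rewrite circuitE eqxx.
rewrite -mulNrn -iterD; apply: walk_iter => z.
by rewrite circuitE eqxx orbT.
Qed.

Definition nbr_seq n d (x : 'I_n.+2) : seq 'I_n.+2 :=
  [seq x + m%:R | m <- iota 1 d] ++ [seq x - m%:R | m <- iota 1 d].

Lemma natr_inj_lt n m k : (m < n.+2)%N -> (k < n.+2)%N ->
  (m%:R : 'I_n.+2) = k%:R -> m = k.
Proof. by move=> mn kn /(congr1 val); rewrite /= !val_natr !modn_small. Qed.

(** A coincidence would make i - j or i + j vanish modulo the order, with
    i, j <= d; the second case is where 2d has to be less than the order. *)
Lemma nbr_seq_uniq n d (x : 'I_n.+2) : (2 * d < n.+2)%N -> uniq (nbr_seq d x).
Proof.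
move=> dn; rewrite cat_uniq; apply/and3P; split.
- rewrite map_inj_in_uniq ?iota_uniq // => i j.
  rewrite !mem_iota => hi hj /addrI; apply: natr_inj_lt; lia.
- apply/hasPn => _ /mapP[i hi ->]; apply/mapP => -[j hj].
  move: hi hj; rewrite !mem_iota => hi hj /addrI /eqP.
  rewrite eq_sym -subr_eq0 opprK -natrD => /eqP; rewrite -[0]/(0%:R).
  move/natr_inj_lt; lia.
- rewrite map_inj_in_uniq ?iota_uniq // => i j.
  rewrite !mem_iota => hi hj /addrI /oppr_inj; apply: natr_inj_lt; lia.
Qed.

Lemma mem_nbr_seq n d (x y : 'I_n.+2) : (2 * d < n.+2)%N ->
  (y \in nbr_seq d x) = dist_power (@circuit n.+2) d x y.
Proof.
move=> dn; rewrite mem_cat; apply/idP/idP => [h|].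
  have [m hm hy] : exists2 m, (0 < m <= d)%N & y = x + m%:R \/ y = x - m%:R.
    by case/orP: h => /mapP[m]; rewrite mem_iota add1n ltnS => hm ->;
      exists m => //; [left|right].
  have m0 : (m%:R : 'I_n.+2) != 0.
    by apply/eqP; rewrite -[0]/(0%:R) => /natr_inj_lt; lia.
  apply/dist_powerP; first by rewrite card_ord; lia.
  split.
    case: hy => ->; rewrite eq_sym -subr_eq0 addrC addKr //.
    by rewrite oppr_eq0.
  exists m; first lia.
  by have [wp wm] := circuit_walk m x; case: hy => ->.
case/dist_powerP; first by rewrite card_ord; lia.
move=> xy [k kd /walk_circuit[m mk hy]].
have m0 : (0 < m)%N.
  rewrite lt0n; apply: contra xy => /eqP m0; move: hy; rewrite m0.
  by rewrite subr0 addr0; case=> ->.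
have mi : m \in iota 1 d by rewrite mem_iota; lia.
by case: hy => ->; apply/orP; [left|right]; apply: map_f.
Qed.

(** * The spectrum of the distance power *)

(** The eigenvalue attached to a root of unity z; for z = exp (i t) it is the
    sum of 2 cos (m t) over 1 <= m <= d. *)
Definition power_eig (F : fieldType) d (z : F) : F :=
  \sum_(1 <= m < d.+1) (z ^+ m + z ^- m).

(** The powers of a root of unity z form an eigenvector: moving from x to
    x + m or x - m multiplies z ^ x by z ^ m or z ^ -m, even when the index
    wraps around. *)
Lemma adjacency_mul_geometric (F : fieldType) n d (z : F) (x : 'I_n.+2) :
  (2 * d < n.+2)%N -> z ^+ n.+2 = 1 ->
  \sum_y adjacency F (dist_power (@circuit n.+2) d) x y * z ^+ y
    = z ^+ x * power_eig d z.
Proof.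
move=> dn zn; have z0 : z != 0.
  by apply/eqP => z0; move/eqP: zn; rewrite z0 expr0n eq_sym oner_eq0.
have zD (a b : 'I_n.+2) : z ^+ (a + b)%R = z ^+ a * z ^+ b.
  by rewrite /= -exprD (expr_mod _ zn).
have zn_nat m : z ^+ (m%:R : 'I_n.+2) = z ^+ m by rewrite val_natr (expr_mod _ zn).
transitivity (\sum_(y <- nbr_seq d x) z ^+ y).
  rewrite (big_uniq _ (nbr_seq_uniq x dn)) [RHS]big_mkcond.
  apply: eq_bigr => y _; rewrite mxE mem_nbr_seq //.
  by case: dist_power; rewrite ?mul1r ?mul0r.
rewrite big_cat !big_map /= -big_split /= mulr_sumr /index_iota subn1.
apply: eq_bigr => m _; rewrite zD zn_nat mulrDr; congr (_ + _).
(* z ^ (x - m) = z ^ x * z ^ -m is checked after multiplication by z ^ m. *)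
apply: (mulIf (expf_neq0 m z0)); rewrite -mulrA mulVf ?expf_neq0 // mulr1.
by rewrite -[in RHS](subrK m%:R x) zD zn_nat.
Qed.

(** The eigenvectors given by the powers of w are the columns of a Vandermonde
    matrix with distinct nodes. *)
Lemma char_poly_dist_power_circuit (F : fieldType) n d (w : F) :
  (2 * d < n.+2)%N -> n.+2.-primitive_root w ->
  char_poly (adjacency F (dist_power (@circuit n.+2) d))
    = \prod_(j < n.+2) ('X - (power_eig d (w ^+ j))%:P).
Proof.
move=> dn wP; pose a : 'rV[F]_n.+2 := \row_j w ^+ j.
rewrite (@char_poly_diagonalized _ _ _ (Vandermonde n.+2 a)
  (\row_j power_eig d (w ^+ j))).
- by apply: eq_bigr => j _; rewrite mxE.
- apply: det_Vandermonde_neq0 => i j; rewrite !mxE => /eqP.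
  by rewrite (eq_prim_root_expr wP) !modn_small // => /eqP/val_inj.
apply/matrixP => x j; rewrite mul_mx_diag !mxE.
rewrite -(adjacency_mul_geometric x dn); last first.
  by rewrite exprAC (prim_expr_order wP) expr1n.
by apply: eq_bigr => y _; rewrite !mxE.
Qed.

Lemma power_eigV (F : fieldType) d (z : F) : power_eig d z^-1 = power_eig d z.
Proof. by apply: eq_bigr => m _; rewrite exprVn invrK addrC. Qed.

Lemma power_eig1 (F : fieldType) d : power_eig d (1 : F) = (2 * d)%:R.
Proof.
rewrite /power_eig (eq_bigr (fun=> 2%:R)) => [|m _].
  by rewrite sumr_const_nat subSS subn0 natrM mulr_natr.
by rewrite expr1n invr1 -mulr2n.
Qed.

Lemma power_eigN1 (F : fieldType) d :
  power_eig d (-1 : F) = if odd d then - 2 else 0.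
Proof.
rewrite /power_eig; elim: d => [|d IHd]; first by rewrite big_geq.
rewrite big_nat_recr //= IHd -signr_odd /=.
case: (odd d); rewrite /= ?expr0 ?expr1 ?invrN ?invr1.
  by rewrite -mulr2n addNr.
by rewrite add0r -opprD -mulr2n.
Qed.

Lemma power_eig_selfinverse (F : fieldType) d (z : F) : z ^+ 2 = 1 ->
  [\/ power_eig d z = (2 * d)%:R, power_eig d z = 0 | power_eig d z = - 2].
Proof.
move=> z2; have /orP[] : (z == 1) || (z == -1) by rewrite -sqrf_eq1 z2.
  by move/eqP->; constructor 1; rewrite power_eig1.
move/eqP->; rewrite power_eigN1.
by case: (odd d); [constructor 3|constructor 2].
Qed.

Lemma eig_mult_dist_power_circuit (F K : fieldType) (f : {rmorphism F -> K})
    n d (w : K) (lam : F) :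
  (2 * d < n.+2)%N -> n.+2.-primitive_root w ->
  eig_mult (adjacency F (dist_power (@circuit n.+2) d)) lam
    = #|[set j : 'I_n.+2 | power_eig d (w ^+ j) == f lam]|.
Proof.
move=> dn wP; set A := adjacency F _.
rewrite /eig_mult -(mup_map_poly f) ?monic_neq0 ?char_poly_monic //.
rewrite map_char_poly.
have -> : map_mx f A = adjacency K (dist_power (@circuit n.+2) d).
  by apply/matrixP => i j; rewrite !mxE rmorph_nat.
rewrite (char_poly_dist_power_circuit dn wP).
rewrite -(big_map (fun j : 'I_n.+2 => power_eig d (w ^+ j)) xpredT
  (fun y => 'X - y%:P)) mu_prod_XsubC count_map.
by rewrite -sum1_count -sum1_card; apply: eq_bigl => j; rewrite !inE.
Qed.

Lemma prim_root_exp_opp (F : fieldType) n (w : F) (j : 'I_n.+2) :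
  n.+2.-primitive_root w -> w ^+ (- j)%R = (w ^+ j)^-1.
Proof.
move=> wP.
have w0 : w ^+ j != 0 by rewrite expf_neq0 // (prim_root_eq0 wP).
apply: (mulIf w0); rewrite mulVf // -exprD -(prim_expr_mod wP) /=.
by rewrite modnDml subnK ?modnn // ltnW.
Qed.

Theorem mainTheorem8 (R : rcfType) (n d : nat)
    (hd : (1 <= d)%N) (hdn : (2 * d < n - 1)%N) (lam : R)
    (hlam : eigenvalue (adjacency R (dist_power (@circuit n) d)) lam)
    (hodd : odd (eig_mult (adjacency R (dist_power (@circuit n) d)) lam)) :
  [\/ lam = (2 * d)%:R, lam = 0 | lam = - 2].
Proof.
clear hlam; case: n => [|[|n]] in hdn hodd *; [lia|lia|].
have dn : (2 * d < n.+2)%N by lia.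
pose f : {rmorphism R -> R[i]} := real_complex R.
have [w wP] := @prim_root_exists R[i] n.+2 isT.
rewrite (eig_mult_dist_power_circuit f lam dn wP) in hodd.
(* Inversion of roots of unity is negation of their exponents modulo n. *)
have [j jS jN] : exists2 j : 'I_n.+2, power_eig d (w ^+ j) = f lam & - j = j.
  set S := [set _ | _] in hodd.
  have [/exists_inP[j jS /eqP jN]|h] := boolP [exists j in S, - j == j].
    by exists j => //; apply/eqP; move: jS; rewrite inE.
  have : ~~ odd #|S|; last by rewrite hodd.
  apply: (even_card_involutive (@opprK 'I_n.+2)).
    by move=> x; rewrite !inE (prim_root_exp_opp x wP) power_eigV.
  by move=> x xS; apply: contra h => xN; apply/exists_inP; exists x.
have wj2 : (w ^+ j) ^+ 2 = 1.
  rewrite expr2 -{2}jN (prim_root_exp_opp j wP) mulfV //.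
  by rewrite expf_neq0 // (prim_root_eq0 wP).
have finj : injective f := fmorph_inj f.
case: (power_eig_selfinverse d wj2); rewrite jS => E.
- by constructor 1; apply: finj; rewrite E rmorph_nat.
- by constructor 2; apply: finj; rewrite E rmorph0.
- by constructor 3; apply: finj; rewrite E rmorphN rmorph_nat.
Qed.
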